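(* Let $S \subseteq \mathbb{Z}$ with $|S| = 4$. Then $p_{\mathbb{Z}}(S) \ge 3$; that is, there is a coloring of $\mathbb{Z}$ with $3$ colors such that every translate $n+S$, $n \in \mathbb{Z}$, contains an element of each of the three colors.
   Context: For an abelian group $G$, $S \subseteq G$ and $n \in G$, the set $n+S=\{n+s : s\in S\}$ is a translate of $S$. A coloring of the elements of $G$ is $S$-polychromatic if every translate of $S$ contains an element of each color. The polychromatic number $p_G(S)$ (written $p(S)$ when $G$ is clear) is the largest number of colors for which an $S$-polychromatic coloring of $G$ exists. *)

(* Defs.v *)
From mathcomp Require Import all_boot all_order all_algebra.
Set Implicit Arguments. Unset Strict Implicit. Unset Printing Implicit Defensive.
Import GRing.Theory.
Local Open Scope ring_scope.

(* A finite subset S of an abelian group G is represented by a duplicate-free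
   sequence S : seq G.  A coloring of G with k colors is a function G -> 'I_k.
   It is S-polychromatic if every translate n + S contains each color. *)
Definition translate (G : zmodType) (n : G) (S : seq G) : seq G :=
  [seq n + s | s <- S].

Definition polychromatic (G : zmodType) (k : nat) (S : seq G) (c : G -> 'I_k) : Prop :=
  forall (n : G) (i : 'I_k), exists2 x, x \in translate n S & c x = i.

(* Main.v *)
Require Import Defs.
From Stdlib Require Import ZArith Znumtheory.
From mathcomp Require Import all_boot all_order all_algebra.
From mathcomp Require Import zify ssrZ.
Set Implicit Arguments.
Unset Strict Implicit.
Unset Printing Implicit Defensive.
Import GRing.Theory.

(** Translate and rescale so that S = {0, a, b, c} with 0 < a < b < c coprime,
    and put m = b + c - a, so that S = {0, b, c, b + c} modulo m.  If for some k
    the four points k S of the circle Z/mZ have all gaps at most m/3, coloring n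
    by the third of the circle containing k n is polychromatic.  In terms of
    (s, t) = (k b, k c) the gap condition defines a fixed region of the torus,
    and the point is to find in it a vector of the lattice L spanned by (b, c)
    modulo m.

    - If m > 225, the pigeonhole principle gives a nonzero (X, Y) in L with
      |X|, |Y| <= m/15, and up to symmetry 0 <= Y <= X.  Every line through the
      origin with slope in (0, 1) meets the region in a chord longer than such a
      step.  If the slope is 0 or 1, translate the line by another vector of L;
      this fails only if 2 (b - c) or 2 (b + c) is 0 modulo m.
    - If 35 < m <= 225, all possible lattices are enumerated in Hermite normal
      form.
    - If m <= 35, other moduli than m serve, except for {0, 1, 7, 9} and its
      mirror image, which get an explicit word of period 15.

    The exceptional case 2 (b - c) = 0 or 2 (b + c) = 0 modulo m means that S
    is a translate of some {0, p, q, - p - q}.  After division by gcd (p, q),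
    two of p, q, - p - q are odd, and one of these is at least 3 in absolute
    value: let p be that one and q the other, and p > 0 by symmetry.  Modulo 2p
    the set is then a multiple of {0, 1, p - 1, p}, which is colored by an
    explicit word. *)

Definition colorable (G : zmodType) (k : nat) (S : seq G) : Prop :=
  exists c : G -> 'I_k, polychromatic S c.

Lemma polychromatic_transfer (G H : zmodType) (k : nat) (S : seq G) (T : seq H)
    (h : G -> H) (c : H -> 'I_k) (d : G -> 'I_k) :
  (forall t, t \in T ->
     exists2 s, s \in S & forall n, d (n + s)%R = c (h n + t)%R) ->
  polychromatic T c -> polychromatic S d.
Proof.
move=> ST Tc n i; have [_ /mapP[t Tt ->] <-] := Tc (h n) i.
by have [s Ss dE] := ST t Tt; exists (n + s)%R; first exact: map_f.
Qed.

Lemma colorable_subset (G : zmodType) (k : nat) (S T : seq G) :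
  {subset T <= S} -> colorable k T -> colorable k S.
Proof.
move=> subTS [c Tc]; exists c; apply: (polychromatic_transfer (h := id)) Tc.
by move=> t /subTS; exists t.
Qed.

Lemma colorable_additive (G H : zmodType) (k : nat) (f : {additive G -> H})
    (S : seq G) :
  colorable k (map f S) -> colorable k S.
Proof.
case=> c fSc; exists (c \o f); apply: (polychromatic_transfer (h := f)) fSc.
by move=> _ /mapP[s Ss ->]; exists s => // n; rewrite /= raddfD.
Qed.

Local Open Scope Z_scope.
Local Coercion Z.of_nat : nat >-> Z.
Local Arguments Z.mul : simpl never.
Local Arguments Z.of_nat : simpl never.

Lemma colorable_affine (k : nat) (g a : Z) (S : seq Z) :
  g <> 0 -> colorable k S -> colorable k [seq a + g * s | s <- S].
Proof.
move=> g_neq0 [c Sc]; have divE n s : (n + (a + g * s)) / g = (n + a) / g + s.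
  by rewrite -Z.div_add //; congr (_ / g); ring.
exists (fun x => c (x / g)).
apply: (polychromatic_transfer (h := fun n => (n + a) / g)) Sc => s Ss.
by exists (a + g * s) => [|n]; [exact: map_f | congr c; exact: divE].
Qed.

(** * Cyclic colorings *)

Definition cyclic_colorable (m : Z) (k : nat) (S : seq Z) : Prop :=
  exists2 c : Z -> 'I_k, (forall x q, c (x + m * q) = c x) & polychromatic S c.

Lemma colorable_residues (m u : Z) (k : nat) (S T : seq Z) :
  cyclic_colorable m k T ->
  (forall t, t \in T -> exists2 s, s \in S & (m | u * s - t)) ->
  colorable k S.
Proof.
case=> c c_per Tc TS; exists (fun x => c (u * x)).
apply: (polychromatic_transfer (h := Z.mul u)) Tc => t Tt.
have [s Ss [q def_q]] := TS t Tt; exists s => // n.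
by rewrite -(c_per (u * n + t)%R q); congr c; rewrite /GRing.add /=; lia.
Qed.

Lemma cyclic_colorable_word (m : Z) (k : nat) (S : seq Z) (w : Z -> Z) :
  0 < m ->
  (forall x i, 0 <= x < m -> 0 <= i < k.+1 ->
     exists2 s, s \in S & w ((x + s) mod m) = i) ->
  cyclic_colorable m k.+1 S.
Proof.
move=> m_gt0 wS; exists (fun x => inord (Z.to_nat (w (x mod m)))) => [x q|n i].
  by rewrite (Z.mul_comm m) Z.mod_add; last lia.
have i_bounds : 0 <= i < k.+1 by have := ltn_ord i; lia.
have [s Ss def_i] := wS (n mod m) i (Z.mod_pos_bound n m m_gt0) i_bounds.
exists (n + s)%R; first exact: map_f.
rewrite /GRing.add /= -Z.add_mod_idemp_l; last lia.
by rewrite def_i Nat2Z.id inord_val.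
Qed.

(* The circle Z/mZ is cut into r arcs of length m/r. *)
Definition arc_index (r m x : Z) : Z := r * (x mod m) / m.

Lemma arc_indexP (r m x i : Z) : 0 < m -> 0 <= i < r ->
  arc_index r m x = i <-> exists q, i * m <= r * (x + m * q) < (i + 1) * m.
Proof.
move=> m_gt0 i_r; have x_mod := Z.mod_pos_bound x m m_gt0.
have def_x := Z.div_mod x m ltac:(lia); rewrite /arc_index.
split=> [<-|[q q_window]].
- exists (- (x / m)); have -> : x + m * - (x / m) = x mod m by lia.
  have := Z.div_mod (r * (x mod m)) m ltac:(lia).
  by have := Z.mod_pos_bound (r * (x mod m)) m m_gt0; lia.
- have -> : x mod m = x + m * q.
    by symmetry; apply: (Z.mod_unique_pos _ _ (- q)); nia.
  by symmetry; apply: (Z.div_unique_pos _ _ _ (r * (x + m * q) - i * m)); nia.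
Qed.

Lemma arc_index_bounds (r m x : Z) : 0 < r -> 0 < m -> 0 <= arc_index r m x < r.
Proof.
move=> r_gt0 m_gt0; rewrite /arc_index.
have x_mod := Z.mod_pos_bound x m m_gt0.
by split; [apply: Z.div_pos | apply: Z.div_lt_upper_bound]; nia.
Qed.

Lemma same_arc_close (r m x y : Z) : 0 < r -> 0 < m ->
  arc_index r m x = arc_index r m y -> exists q, r * Z.abs (x - y + m * q) < m.
Proof.
move=> r_gt0 m_gt0 same_arc; have y_arc := @arc_index_bounds r m y r_gt0 m_gt0.
have [q q_window] := (arc_indexP y m_gt0 y_arc).1 erefl.
have [p p_window] := (arc_indexP x m_gt0 y_arc).1 same_arc.
by exists (p - q); nia.
Qed.

Definition gaps_at_most (r m : Z) (a : Z) (s : seq Z) : bool :=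
  path (fun x y => r * (y - x) <=? m) a (rcons s (a + m)).

Lemma path_meets_window (r m t x : Z) (s : seq Z) :
  path (fun y z => r * (z - y) <=? m) x s -> r * x < t <= r * last x s ->
  exists2 y, y \in s & t <= r * y < t + m.
Proof.
elim: s x => [|y s IHs] x /=; first by lia.
case/andP=> step_xy path_s x_lt_t.
have [t_le_y|y_lt_t] := Z_le_gt_dec t (r * y).
  by exists y; [rewrite inE eqxx | lia].
have [|z s_z z_window] := IHs y path_s; first lia.
by exists z; first by rewrite inE s_z orbT.
Qed.

Lemma cyclic_colorable_gaps (k : nat) (m a : Z) (s : seq Z) :
  0 < m -> gaps_at_most k.+1 m a s -> cyclic_colorable m k.+1 (a :: s).
Proof.
move=> m_gt0 gaps.
apply: (@cyclic_colorable_word m k _ (arc_index k.+1 m)) => // x i x_m i_k.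
set r : Z := k.+1 in gaps i_k *; set t := i * m - r * x.
(* [q] is the last turn in which [a] precedes the end [t + m] of the arc [i]. *)
have [q q_last] : exists q, t + m - r * m <= r * (a + m * q) < t + m.
  exists ((t + m - 1 - r * a) / (r * m)).
  have := Z.div_mod (t + m - 1 - r * a) (r * m) ltac:(nia).
  by have := Z.mod_pos_bound (t + m - 1 - r * a) (r * m) ltac:(nia); lia.
have arc_q y : t <= r * (y + m * q) < t + m ->
    arc_index r m ((x + y) mod m) = i.
  move=> y_window; rewrite /arc_index Zmod_mod -/(arc_index r m (x + y)).
  by apply/arc_indexP => //; exists q; lia.
have [t_le_a|a_lt_t] := Z_le_gt_dec t (r * (a + m * q)).
  by exists a; [rewrite inE eqxx | apply: arc_q; nia].
have [|y] := path_meets_window (t := t - r * m * q) gaps.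
  by rewrite last_rcons; nia.
rewrite mem_rcons inE => /orP[/eqP->|s_y] y_window; first by nia.
by exists y; [rewrite inE s_y orbT | apply: arc_q; nia].
Qed.

(** * Lattices of the torus and the spread region *)

(* The points 0, s, t, s + t of the circle Z/mZ have all their gaps at most m/3:
   (s, t) lies in the diamond of radius m/3 around (m/2, m/2), outside the
   square inscribed in it. *)
Definition spread (m s t : Z) : bool :=
  (3 * Z.abs (2 * s - m) + 3 * Z.abs (2 * t - m) <=? 2 * m) &&
  ((m <=? 3 * Z.abs (2 * s - m)) || (m <=? 3 * Z.abs (2 * t - m))).

Definition in_lattice (m x y s t : Z) : Prop :=
  exists k p q, s = k * x + m * p /\ t = k * y + m * q.

Definition hits_spread (m x y : Z) : Prop :=
  exists s t, in_lattice m x y s t /\ spread m s t.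

Lemma in_lattice_gen (m x y : Z) : in_lattice m x y x y.
Proof. by exists 1, 0, 0; lia. Qed.

Lemma in_lattice_lincomb (m x y s t s' t' i j : Z) :
  in_lattice m x y s t -> in_lattice m x y s' t' ->
  in_lattice m x y (i * s + j * s') (i * t + j * t').
Proof.
move=> [k [p [q [-> ->]]]] [k' [p' [q' [-> ->]]]].
by exists (i * k + j * k'), (i * p + j * p'), (i * q + j * q'); split; ring.
Qed.

Lemma in_lattice_shift (m x y s t p q : Z) :
  in_lattice m x y s t -> in_lattice m x y (s + m * p) (t + m * q).
Proof.
move=> [k [p' [q' [-> ->]]]].
by exists k, (p' + p), (q' + q); split; ring.
Qed.

Lemma in_lattice_trans (m x y X Y s t : Z) :
  in_lattice m x y X Y -> in_lattice m X Y s t -> in_lattice m x y s t.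
Proof.
move=> [k [p [q [-> ->]]]] [k' [p' [q' [-> ->]]]].
by exists (k' * k), (k' * p + p'), (k' * q + q'); split; ring.
Qed.

Lemma in_lattice_swap (m x y s t : Z) :
  in_lattice m x y s t -> in_lattice m y x t s.
Proof. by move=> [k [p [q [def_s def_t]]]]; exists k, q, p. Qed.

Lemma in_lattice_oppl (m x y s t : Z) :
  in_lattice m x y s t -> in_lattice m (- x) y (- s) t.
Proof.
by move=> [k [p [q [-> ->]]]]; exists k, (- p), q; split; ring.
Qed.

Lemma hits_spread_trans (m x y X Y : Z) :
  in_lattice m x y X Y -> hits_spread m X Y -> hits_spread m x y.
Proof.
move=> L_XY [s [t [L_st st]]]; exists s, t; split=> //.
exact: in_lattice_trans L_st.
Qed.

Lemma hits_spread_swap (m x y : Z) : hits_spread m x y -> hits_spread m y x.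
Proof.
move=> [s [t [/in_lattice_swap L st]]]; exists t, s; split=> //.
by move: st; rewrite /spread; lia.
Qed.

Lemma hits_spread_oppl (m x y : Z) : hits_spread m (- x) y -> hits_spread m x y.
Proof.
move=> [s [t [/in_lattice_oppl]]]; rewrite Z.opp_involutive => L st.
exists (- s + m * 1), (t + m * 0); split; first exact: in_lattice_shift.
by move: st; rewrite /spread; lia.
Qed.

Lemma colorable_hits_spread (m x y z : Z) :
  0 < m -> (m | x + y - z) -> hits_spread m x y -> colorable 3 [:: 0; x; y; z].
Proof.
move=> m_gt0 [d def_d] [s [t [[k [p [q [def_s def_t]]]] spread_st]]].
wlog s_le_t : x y s t p q def_d def_s def_t spread_st / s <= t => [ordered|].
  have [s_le_t|t_lt_s] := Z_le_gt_dec s t; first exact: (ordered x y s t p q).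
  apply: (colorable_subset (T := [:: 0; y; x; z])).
    by move=> w; rewrite !inE => /or4P[]->; rewrite ?orbT.
  apply: (ordered y x t s q p) => //; try lia.
  by move: spread_st; rewrite /spread; lia.
pose residue w := exists2 v, v \in [:: 0; x; y; z] & (m | k * v - w).
have residue_0 : residue 0 by exists 0; [rewrite inE eqxx | exists 0; lia].
have residue_s : residue s.
  by exists x; [rewrite !inE eqxx orbT | exists (- p); lia].
have residue_t : residue t.
  by exists y; [rewrite !inE eqxx !orbT | exists (- q); lia].
have residue_sum j : residue (s + t - m * j).
  by exists z; [rewrite !inE eqxx !orbT | exists (j - (p + q + k * d)); nia].
have [sum_le|sum_gt] := Z_le_gt_dec (s + t) m.
- apply: (@colorable_residues m k 3 _ [:: 0; s; t; s + t - m * 0]).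
    apply: cyclic_colorable_gaps => //.
    by move: spread_st; rewrite /spread /gaps_at_most /=; lia.
  by move=> w; rewrite !inE => /or4P[] /eqP->; last exact: (residue_sum 0).
- apply: (@colorable_residues m k 3 _ [:: 0; s + t - m * 1; s; t]).
    apply: cyclic_colorable_gaps => //.
    by move: spread_st; rewrite /spread /gaps_at_most /=; lia.
  by move=> w; rewrite !inE => /or4P[] /eqP->; [|exact: (residue_sum 1)| |].
Qed.

(** * Large moduli *)

Lemma multiple_in_window (X T : Z) : 0 < X -> exists k, T <= k * X < T + X.
Proof.
move=> X_gt0; exists (- ((- T) / X)).
have := Z.div_mod (- T) X ltac:(lia).
by have := Z.mod_pos_bound (- T) X X_gt0; lia.
Qed.

(* The multiples of y modulo m are those of m/h for some integer h >= 3, and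
   there is an integer between h/5 and h/3. *)
Lemma exists_multiple_fifth_third (m y : Z) :
  0 < m -> ~ (m | 2 * y) ->
  exists k q, m <= 5 * (k * y + m * q) /\ 3 * (k * y + m * q) <= m.
Proof.
move=> m_gt0 m_ndiv; have [a [b bezout]] := Z.gcd_bezout y m _ erefl.
have [c def_y] := Z.gcd_divide_l y m; have [h def_m] := Z.gcd_divide_r y m.
have := Z.gcd_nonneg y m.
move: (Z.gcd y m) bezout def_y def_m => g bezout def_y def_m g_ge0.
have h_neq1 : h <> 1 by move=> h_eq1; apply: m_ndiv; exists (2 * c); nia.
have h_neq2 : h <> 2 by move=> h_eq2; apply: m_ndiv; exists c; nia.
have g_gt0 : 0 < g by nia.
have h_ge3 : 3 <= h by nia.
have [j h_j] : exists j, 3 * j <= h <= 5 * j.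
  exists (h / 3); have := Z.div_mod h 3 ltac:(lia).
  by have := Z.mod_pos_bound h 3 ltac:(lia); lia.
exists (j * a), (j * b).
have -> : j * a * y + m * (j * b) = j * g by rewrite -bezout; ring.
by nia.
Qed.

(* Bring the slow coordinate, of step [Y], to [B m/15], then turn until the fast
   one, of step [X], next reaches [A m/15], after about one turn at most. *)
Lemma sweep (m X Y A B d : Z) :
  0 < d -> 0 < Y -> d * Y <= X -> 15 * X <= m ->
  exists k p, A * m <= 15 * (k * X + m * p) <= (A + 1) * m /\
    B * m <= 15 * (k * Y) /\ 15 * d * (k * Y) <= (B * d + 17) * m.
Proof.
move=> d_gt0 Y_gt0 slope step.
have [k0 slow_start] := multiple_in_window (X := 15 * Y) (B * m) ltac:(lia).
have [p next_turn] :=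
  multiple_in_window (X := 15 * m) (15 * (k0 * X) - A * m) ltac:(lia).
have [k fast_window] :=
  multiple_in_window (X := 15 * X) (A * m + 15 * (p * m)) ltac:(nia).
have k0_le_k : k0 <= k by nia.
have slow_advance : d * ((k - k0) * Y) <= (k - k0) * X by nia.
by exists k, (- p); nia.
Qed.

Lemma hits_spread_flat (m X Y : Z) :
  0 < Y -> 9 * Y <= X -> 15 * X <= m -> hits_spread m X Y.
Proof.
move=> Y_gt0 slope step.
have [k [p windows]] := @sweep m X Y 7 3 9 ltac:(lia) Y_gt0 slope step.
exists (k * X + m * p), (k * Y + m * 0); split; first by exists k, p, 0.
by rewrite /spread; lia.
Qed.

(* Here X - Y is the slow coordinate. *)
Lemma hits_spread_diagonal (m X Y : Z) :
  Y < X -> 6 * X <= 7 * Y -> 15 * X <= m -> hits_spread m X Y.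
Proof.
move=> Y_lt_X slope step.
have [k [p windows]] :=
  @sweep m Y (X - Y) 4 2 6 ltac:(lia) ltac:(lia) ltac:(lia) ltac:(lia).
exists (k * X + m * p), (k * Y + m * p); split; first by exists k, p, p.
by rewrite /spread; lia.
Qed.

(* A window [A m/60, (A + 4) m/60] for s is as long as the largest step allowed,
   so it suffices that it works for all slopes between n1/d1 and n2/d2. *)
Lemma hits_spread_window (A p q n1 d1 n2 d2 m X Y : Z) :
  0 <= A -> 0 < X -> 15 * X <= m -> n1 * X <= d1 * Y -> d2 * Y <= n2 * X ->
  (forall u v, A * m <= 60 * u <= (A + 4) * m -> n1 * u <= d1 * v ->
     d2 * v <= n2 * u -> spread m (u - m * p) (v - m * q)) ->
  hits_spread m X Y.
Proof.
move=> A_ge0 X_gt0 step slope1 slope2 window.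
have [k k_window] := multiple_in_window (X := 60 * X) (A * m) ltac:(lia).
have k_ge0 : 0 <= k by nia.
exists (k * X - m * p), (k * Y - m * q); split.
  by exists k, (- p), (- q); lia.
by apply: window; nia.
Qed.

Lemma hits_spread_line (m X Y : Z) :
  0 < Y < X -> 15 * X <= m -> hits_spread m X Y.
Proof.
move=> Y_bounds step.
have [?|?] := Z_le_gt_dec (9 * Y) X.
  by apply: hits_spread_flat; lia.
have [?|?] := Z_le_gt_dec (6 * X) (7 * Y).
  by apply: hits_spread_diagonal; lia.
have [?|?] := Z_le_gt_dec (13 * Y) (2 * X).
  by apply: (@hits_spread_window 220 3 0 1 9 2 13); rewrite /spread; lia.
have [?|?] := Z_le_gt_dec (14 * Y) (3 * X).
  by apply: (@hits_spread_window 87 1 0 2 13 3 14); rewrite /spread; lia.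
have [?|?] := Z_le_gt_dec (19 * Y) (5 * X).
  by apply: (@hits_spread_window 136 2 0 3 14 5 19); rewrite /spread; lia.
have [?|?] := Z_le_gt_dec (3 * Y) X.
  by apply: (@hits_spread_window 100 1 0 5 19 1 3); rewrite /spread; lia.
have [?|?] := Z_le_gt_dec (11 * Y) (5 * X).
  by apply: (@hits_spread_window 76 1 0 1 3 5 11); rewrite /spread; lia.
have [?|?] := Z_le_gt_dec (5 * Y) (3 * X).
  by apply: (@hits_spread_window 28 0 0 5 11 3 5); rewrite /spread; lia.
have [?|?] := Z_le_gt_dec (5 * Y) (4 * X).
  by apply: (@hits_spread_window 40 0 0 3 5 4 5); rewrite /spread; lia.
by apply: (@hits_spread_window 89 1 1 4 5 6 7); rewrite /spread; lia.
Qed.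

Lemma hits_spread_horizontal (m x y X : Z) :
  0 < X -> 15 * X <= m -> in_lattice m x y X 0 -> ~ (m | y) ->
  hits_spread m x y.
Proof.
move=> X_gt0 step L_X m_ndiv_y.
have translate s t A : in_lattice m x y s t -> exists2 s',
    in_lattice m x y s' t & A * m <= 15 * s' <= (A + 1) * m.
  move=> L_st.
  have [j j_window] :=
    multiple_in_window (X := 15 * X) (A * m - 15 * s) ltac:(lia).
  exists (s + j * X); last lia.
  have := in_lattice_lincomb 1 j L_st L_X.
  by rewrite Z.mul_0_r !Z.mul_1_l Z.add_0_r.
have [[e def_e]|m_ndiv_2y] := Zdivide_dec m (2 * y).
- have [f half_turn] : exists f, 2 * (y + m * f) = m.
    have [[f def_f]|[f def_f]] := Z.Even_or_Odd e; last by exists (- f); lia.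
    by case: m_ndiv_y; exists f; nia.
  have [s L_s s_window] :=
    translate _ _ 4 (in_lattice_shift 0 f (in_lattice_gen m x y)).
  by exists s, (y + m * f); rewrite /spread; split; last lia.
- have [k [q y_window]] :=
    exists_multiple_fifth_third (m := m) ltac:(lia) m_ndiv_2y.
  have [s L_s s_window] :=
    translate (k * x + m * 0) (k * y + m * q) 7 ltac:(by exists k, 0, q).
  by exists s, (k * y + m * q); rewrite /spread; split; last lia.
Qed.

Lemma hits_spread_equal_steps (m x y X : Z) :
  0 < X -> 15 * X <= m -> in_lattice m x y X X -> ~ (m | 2 * (x - y)) ->
  hits_spread m x y.
Proof.
move=> X_gt0 step L_X m_ndiv.
have [k [q difference_window]] :=
  exists_multiple_fifth_third (m := m) ltac:(lia) m_ndiv.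
have [j j_window] :=
  multiple_in_window (X := 15 * X) (4 * m - 15 * (k * y)) ltac:(lia).
exists (k * x + j * X + m * q), (k * y + j * X + m * 0); split.
  by apply/in_lattice_shift/in_lattice_lincomb/L_X/in_lattice_gen.
by rewrite /spread; lia.
Qed.

Definition generic (m x y : Z) : Prop :=
  [/\ Z.gcd x (Z.gcd y m) = 1, ~ (m | x), ~ (m | y),
      ~ (m | 2 * (x - y)) & ~ (m | 2 * (x + y))].

Lemma generic_swap (m x y : Z) : generic m x y -> generic m y x.
Proof.
case=> coprime_xym m_ndiv_x m_ndiv_y m_ndiv_diff m_ndiv_sum; split=> //.
- by rewrite Z.gcd_assoc (Z.gcd_comm y) -Z.gcd_assoc.
- by rewrite -Z.divide_opp_r; have -> : - (2 * (y - x)) = 2 * (x - y) by ring.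
- by rewrite Z.add_comm.
Qed.

Lemma generic_oppl (m x y : Z) : generic m x y -> generic m (- x) y.
Proof.
case=> coprime_xym m_ndiv_x m_ndiv_y m_ndiv_diff m_ndiv_sum; split=> //.
- by rewrite Z.gcd_opp_l.
- by rewrite Z.divide_opp_r.
- by rewrite -Z.divide_opp_r; have -> : - (2 * (- x - y)) = 2 * (x + y) by ring.
- by rewrite -Z.divide_opp_r; have -> : - (2 * (- x + y)) = 2 * (x - y) by ring.
Qed.

Lemma divide_of_multiples (m x y k : Z) :
  Z.gcd x (Z.gcd y m) = 1 -> (m | k * x) -> (m | k * y) -> (m | k).
Proof.
move=> coprime_xym m_kx m_ky.
have m_gcd : (m | Z.gcd (k * x) (Z.gcd (k * y) (k * m))).
  by apply: Z.gcd_greatest => //; apply: Z.gcd_greatest => //; exists k.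
have gcd_ge0 := Z.gcd_nonneg y m.
by move: m_gcd; rewrite Z.gcd_mul_mono_l -(Z.abs_eq (Z.gcd y m)) // -Z.abs_mul
  Z.gcd_abs_r Z.gcd_mul_mono_l coprime_xym Z.mul_1_r Z.divide_abs_r.
Qed.

Lemma simultaneous_approximation (N : nat) (m x y : Z) : (0 < N)%N -> 0 < m ->
  exists k p q, [/\ 0 < Z.abs k <= N * N,
    N * Z.abs (k * x + m * p) < m & N * Z.abs (k * y + m * q) < m].
Proof.
case: N => // N _ m_gt0.
pose box (i : nat) (z : Z) : 'I_N.+1 :=
  inord (Z.to_nat (arc_index N.+1 m (i * z))).
have box_eq (i j : nat) z : box i z = box j z ->
    exists q, N.+1 * Z.abs ((i - j) * z + m * q) < m.
  have bounds k := @arc_index_bounds N.+1 m (k * z) ltac:(lia) m_gt0.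
  have bound_i := bounds i; have bound_j := bounds j.
  move=> /(congr1 val); rewrite /= !inordK => [same_box||]; try lia.
  by rewrite Z.mul_sub_distr_r; apply: same_arc_close; lia.
pose boxes (i : 'I_(N.+1 * N.+1).+1) := (box i x, box i y).
have /injectivePn[i [j j_neq_i [/box_eq[p close_x] /box_eq[q close_y]]]] :
    ~~ injectiveb boxes.
  by apply/injectiveP => /leq_card; rewrite card_prod !card_ord ltnn.
exists (i - j), p, q; split=> //.
have i_neq_j : i - j <> 0.
  by move=> i_eq_j; case/eqP: j_neq_i; apply: val_inj => /=; lia.
by have := ltn_ord i; have := ltn_ord j; lia.
Qed.

Lemma exists_short_vector (N : nat) (m x y : Z) :
  (0 < N)%N -> N * N < m -> Z.gcd x (Z.gcd y m) = 1 ->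
  exists X Y, [/\ in_lattice m x y X Y, X <> 0 \/ Y <> 0,
    N * Z.abs X <= m & N * Z.abs Y <= m].
Proof.
move=> N_gt0 large coprime_xym.
have [k [p [q [k_bounds close_x close_y]]]] :=
  simultaneous_approximation x y N_gt0 (m := m) ltac:(lia).
exists (k * x + m * p), (k * y + m * q); split; try lia.
  by exists k, p, q.
have [X_eq0|] := Z.eq_dec (k * x + m * p) 0; last by left.
right=> Y_eq0; have m_div_k : (m | k).
  apply: divide_of_multiples coprime_xym _ _.
  - by exists (- p); lia.
  - by exists (- q); lia.
by have := Zdivide_bounds _ _ m_div_k ltac:(lia); lia.
Qed.

Lemma hits_spread_step (m x y X Y : Z) :
  generic m x y -> in_lattice m x y X Y ->
  0 <= Y <= X -> 0 < X -> 15 * X <= m -> hits_spread m x y.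
Proof.
move=> [_ _ m_ndiv_y m_ndiv_diff _] L_XY Y_bounds X_gt0 step.
have [Y_eq0|Y_neq0] := Z.eq_dec Y 0.
  by apply: (hits_spread_horizontal X_gt0) => //; rewrite -Y_eq0.
have [Y_eqX|Y_neqX] := Z.eq_dec Y X.
  by apply: (hits_spread_equal_steps X_gt0) => //; rewrite -{2}Y_eqX.
by apply: (hits_spread_trans L_XY); apply: hits_spread_line; lia.
Qed.

Lemma hits_spread_large (m x y : Z) :
  225 < m -> generic m x y -> hits_spread m x y.
Proof.
move=> large gen; have [X [Y [L_XY XY_neq0 X_short Y_short]]] :
    exists X Y, [/\ in_lattice m x y X Y, X <> 0 \/ Y <> 0,
      15 * Z.abs X <= m & 15 * Z.abs Y <= m].
  by case: gen => coprime_xym _ _ _ _; apply: (@exists_short_vector 15).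
wlog X_ge0 : x X gen L_XY XY_neq0 X_short / 0 <= X => [nonneg|].
  have [X_ge0|X_lt0] := Z_le_gt_dec 0 X; first exact: (nonneg x X).
  apply: hits_spread_oppl; apply: (nonneg (- x) (- X)); try lia.
  - exact: generic_oppl.
  - exact: in_lattice_oppl.
wlog Y_ge0 : y Y gen L_XY XY_neq0 Y_short / 0 <= Y => [nonneg|].
  have [Y_ge0|Y_lt0] := Z_le_gt_dec 0 Y; first exact: (nonneg y Y).
  apply/hits_spread_swap/hits_spread_oppl/hits_spread_swap.
  apply: (nonneg (- y) (- Y)); try lia.
  - exact/generic_swap/generic_oppl/generic_swap.
  - exact/in_lattice_swap/in_lattice_oppl/in_lattice_swap.
wlog Y_le_X : x y X Y gen L_XY XY_neq0 X_short Y_short X_ge0 Y_ge0 /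
    Y <= X => [ordered|].
  have [Y_le_X|X_lt_Y] := Z_le_gt_dec Y X; first exact: (ordered x y X Y).
  apply: hits_spread_swap; apply: (ordered y x Y X); try lia.
  - exact: generic_swap.
  - exact: in_lattice_swap.
by apply: (hits_spread_step gen L_XY); lia.
Qed.

(** * Exhaustive search *)

Definition zrange (a b : Z) : seq Z := traject Z.succ a (Z.to_nat (b - a)).

Lemma mem_zrange (a b i : Z) : (i \in zrange a b) = (a <=? i) && (i <? b).
Proof.
have iterE k : iter k Z.succ a = a + k by elim: k => [|k IHk] /=; lia.
apply/trajectP/idP => [[k k_lt ->]|i_ab]; first by rewrite iterE; lia.
by exists (Z.to_nat (i - a)); rewrite ?iterE; lia.
Qed.

(* Unlike [has], [find] stops at the first success under call by value. *)
Definition search (P : pred Z) (s : seq Z) : bool := (find P s < size s)%N.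

Lemma searchP (P : pred Z) (s : seq Z) :
  reflect (exists2 i, i \in s & P i) (search P s).
Proof. by rewrite /search -has_find; apply: hasP. Qed.

(** * Medium moduli *)

Lemma in_lattice_hnf (m x y : Z) : 0 < m -> Z.gcd x (Z.gcd y m) = 1 ->
  exists g n z i0 j0,
    [/\ [/\ 0 < g, 0 < n & m = g * n], 0 <= z < n,
        x = g * i0, y = z * i0 + n * j0 &
        forall i j, in_lattice m x y (g * i) (z * i + n * j)].
Proof.
move=> m_gt0 coprime_xym.
have [u [v bezout_xm]] := Z.gcd_bezout x m _ erefl.
have [i0 def_x] := Z.gcd_divide_l x m.
have [n def_m] := Z.gcd_divide_r x m.
have coprime_yg : Z.gcd y (Z.gcd x m) = 1.
  by rewrite Z.gcd_assoc (Z.gcd_comm y) -Z.gcd_assoc.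
have : 0 < Z.gcd x m.
  by have := Z.gcd_eq_0_r x m; have := Z.gcd_nonneg x m; lia.
move: (Z.gcd x m) bezout_xm def_x def_m coprime_yg.
move=> g bezout_xm def_x def_m coprime_yg g_gt0.
have n_gt0 : 0 < n by nia.
have [l [h bezout_yg]] := Z.gcd_bezout _ _ _ coprime_yg.
have := Z.div_mod (u * y) n ltac:(lia).
have := Z.mod_pos_bound (u * y) n n_gt0.
move: (u * y / n) ((u * y) mod n) => w z z_n def_uy.
have L_gz : in_lattice m x y g (u * y).
  by exists u, v, 0; split; [rewrite -bezout_xm; ring | ring].
have L_0n : in_lattice m x y 0 n.
  exists (n * l), (- (l * i0)), h; split; first by rewrite def_x def_m; ring.
  by rewrite -[n in LHS]Z.mul_1_r -bezout_yg def_m; ring.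
have i0_unit : u * i0 + v * n = 1 by nia.
exists g, n, z, i0, (w * i0 + v * y); split=> //; first by split=> //; lia.
- by lia.
- transitivity (i0 * (u * y) + n * v * y); last by rewrite def_uy; ring.
  by rewrite -[y in LHS]Z.mul_1_r -i0_unit; ring.
- move=> i j; have := in_lattice_lincomb i (j - i * w) L_gz L_0n.
  have -> : i * g + (j - i * w) * 0 = g * i by ring.
  have -> // : i * (u * y) + (j - i * w) * n = z * i + n * j.
  by rewrite def_uy; ring.
Qed.

(* Starting at n/3 only saves time; below n/6 nothing can be found. *)
Definition hnf_hits (g n z : Z) : bool :=
  search (fun i =>
    search (fun j => spread (g * n) (g * i) ((z * i) mod n + n * j))
      (zrange 0 g))
    (zrange (n / 3) n).

Definition hnf_degenerate (g n z : Z) : bool :=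
  [|| n =? 1, (g =? 1) && (z =? 0) |
      (g <=? 2) && (((2 * (g - z)) mod (g * n) =? 0) ||
                    ((2 * (g + z)) mod (g * n) =? 0))].

Definition hnf_check (lo hi : Z) : bool :=
  all (fun n => all (fun g => all (fun z =>
      if hnf_hits g n z then true else hnf_degenerate g n z)
    (zrange 0 n)) (zrange (lo / n + 1) (hi / n + 1))) (zrange 1 (hi + 1)).

Lemma hnf_checkP (lo hi g n z : Z) :
  hnf_check lo hi -> 0 < g -> 0 < n -> lo < g * n <= hi -> 0 <= z < n ->
  hnf_hits g n z \/ hnf_degenerate g n z.
Proof.
move=> check g_gt0 n_gt0 m_bounds z_bounds.
have n_range : n \in zrange 1 (hi + 1) by rewrite mem_zrange; nia.
have g_range : g \in zrange (lo / n + 1) (hi / n + 1).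
  have := Z.div_lt_upper_bound lo n g; have := Z.div_le_lower_bound hi n g.
  by rewrite mem_zrange; lia.
have z_range : z \in zrange 0 n by rewrite mem_zrange; lia.
have := allP (allP (allP check n n_range) g g_range) z z_range.
by case: ifP; [left | right].
Qed.

Lemma hnf_degenerateP (g n z i j : Z) : 0 < g -> 0 < n ->
  hnf_degenerate g n z -> ~ generic (g * n) (g * i) (z * i + n * j).
Proof.
move=> g_gt0 n_gt0; rewrite /hnf_degenerate => degenerate.
move=> [_ m_ndiv_x m_ndiv_y m_ndiv_diff m_ndiv_sum].
have {degenerate} : n = 1 \/ g = 1 /\ z = 0 \/ g <= 2 /\
    ((2 * (g - z)) mod (g * n) = 0 \/ (2 * (g + z)) mod (g * n) = 0).
  by lia.
case=> [n_eq1|[[g_eq1 z_eq0]|[g_le2 sum_or_diff]]].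
- by apply: m_ndiv_x; exists i; rewrite n_eq1; ring.
- by apply: m_ndiv_y; exists j; rewrite g_eq1 z_eq0; ring.
have [r def_2] : exists r, 2 = r * g.
  by have [->|->] : g = 1 \/ g = 2; [lia | exists 2 | exists 1].
case: sum_or_diff => /Z.mod_divide[|e def_e]; try nia.
- apply: m_ndiv_diff; exists (e * i - r * j).
  transitivity (2 * (g - z) * i - 2 * (n * j)); first by ring.
  by rewrite def_e def_2; ring.
- apply: m_ndiv_sum; exists (e * i + r * j).
  transitivity (2 * (g + z) * i + 2 * (n * j)); first by ring.
  by rewrite def_e def_2; ring.
Qed.

Lemma hnf_check_35_225 : hnf_check 35 225.
Proof. by vm_compute. Qed.

Lemma hits_spread_medium (m x y : Z) :
  35 < m <= 225 -> generic m x y -> hits_spread m x y.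
Proof.
move=> m_bounds gen; have [coprime_xym _ _ _ _] := gen.
have [g [n [z [i0 [j0 [[g_gt0 n_gt0 def_m] z_n def_x def_y L_hnf]]]]]] :=
  in_lattice_hnf (m := m) ltac:(lia) coprime_xym.
have m_range : 35 < g * n <= 225 by rewrite -def_m.
have [hits|degenerate] := hnf_checkP hnf_check_35_225 g_gt0 n_gt0 m_range z_n.
- have /searchP[i _ /searchP[j _ spread_ij]] := hits.
  exists (g * i), ((z * i) mod n + n * j); split; last by rewrite def_m.
  have -> : (z * i) mod n + n * j = z * i + n * (j - z * i / n).
    by have := Z.div_mod (z * i) n ltac:(lia); lia.
  exact: L_hnf.
- case: (hnf_degenerateP (i := i0) (j := j0) g_gt0 n_gt0 degenerate).
  by rewrite -def_x -def_y -def_m.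
Qed.

(** * Sets {0, p, q, - p - q} *)

Lemma eqZE (x y : Z) : (x == y) = (x =? y).
Proof. by []. Qed.

(* The word 0101...012 0202...021 of length 2p. *)
Definition twisted_word (p i : Z) : Z :=
  if i =? p - 1 then 2 else if i =? 2 * p - 1 then 1
  else if i <? p then i mod 2 else 2 * ((i - p) mod 2).

Lemma cyclic_colorable_twisted (p : Z) : 3 <= p -> Z.Odd p ->
  cyclic_colorable (2 * p) 3 [:: 0; 1; p - 1; p].
Proof.
move=> p_ge3 [f def_p].
apply: (@cyclic_colorable_word _ 2 _ (twisted_word p)) => [|x i x_p i_3].
  by lia.
have mod_2p d : 0 <= d <= p ->
    (x + d) mod (2 * p) = if x + d <? 2 * p then x + d else x + d - 2 * p.
  move=> d_p; case: Z.ltb_spec => ?; symmetry.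
  - by apply: (Z.mod_unique_pos _ _ 0); lia.
  - by apply: (Z.mod_unique_pos _ _ 1); lia.
pose w d := twisted_word p ((x + d) mod (2 * p)).
suff: w 0 = i \/ w 1 = i \/ w (p - 1) = i \/ w p = i.
  case=> [|[|[|]]]; [exists 0 | exists 1 | exists (p - 1) | exists p] => //;
    by rewrite !inE eqxx ?orbT.
rewrite /w !mod_2p; try lia; rewrite /twisted_word.
repeat (case: Z.ltb_spec => ?; try lia);
  repeat (case: Z.eqb_spec => ?; try lia).
(* Eight kinds of positions [x] remain, and only parities are left to check. *)
all: by Z.to_euclidean_division_equations; lia.
Qed.

(* Modulo 2p, multiplication by the inverse of q turns {0, p, q, - p - q} into
   {0, p, 1, p - 1}. *)
Lemma colorable_zero_sum_odd (p q : Z) :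
  3 <= p -> Z.Odd p -> Z.Odd q -> Z.gcd p q = 1 ->
  colorable 3 [:: 0; p; q; - p - q].
Proof.
move=> p_ge3 p_odd q_odd coprime_pq.
have [[f def_p] [g def_q]] := (p_odd, q_odd).
have [w [v bezout]] : exists w v, (2 * w + 1) * q + 2 * p * v = 1.
  have [a [b bezout_pq]] := Z.gcd_bezout _ _ _ coprime_pq.
  have [[d def_a]|[d def_a]] := Z.Even_or_Odd a;
    have [[c def_b]|[c def_b]] := Z.Even_or_Odd b.
  - by move: bezout_pq; rewrite def_a def_b; lia.
  - by exists c, d; rewrite -[RHS]bezout_pq def_b def_a; ring.
  - exists (c + f), (d - g).
    by rewrite -[RHS]bezout_pq def_b def_a def_p def_q; ring.
  - by move: bezout_pq; rewrite def_a def_b def_p def_q; lia.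
have twisted := cyclic_colorable_twisted p_ge3 p_odd.
apply: (@colorable_residues (2 * p) (2 * w + 1)) twisted _.
move=> t; rewrite !inE => /or4P[] /eqP->.
- by exists 0; [rewrite inE eqxx | exists 0; ring].
- by exists q; [rewrite !inE eqxx !orbT | exists (- v); lia].
- exists (- p - q); first by rewrite !inE eqxx !orbT.
  by exists (v - w - 1); lia.
- by exists p; [rewrite !inE eqxx !orbT | exists w; ring].
Qed.

Lemma colorable_zero_sum_two_odd (p q : Z) :
  Z.Odd p -> Z.Odd q -> Z.gcd p q = 1 -> p <> q -> p + q <> 0 ->
  colorable 3 [:: 0; p; q; - p - q].
Proof.
move=> p_odd q_odd coprime_pq p_neq_q sum_neq0.
wlog p_large : p q p_odd q_odd coprime_pq p_neq_q sum_neq0 /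
    3 <= Z.abs p => [large|].
  have [p_large|p_small] := Z_le_gt_dec 3 (Z.abs p); first exact: large.
  have [[f def_p] [g def_q]] := (p_odd, q_odd).
  apply: (colorable_subset (T := [:: 0; q; p; - q - p])); last first.
    by apply: large => //; rewrite 1?Z.gcd_comm; lia.
  have -> : - q - p = - p - q by ring.
  by move=> w; rewrite !inE => /or4P[]->; rewrite ?orbT.
have [p_pos|p_neg] := Z_le_gt_dec 3 p; first exact: colorable_zero_sum_odd.
have -> : [:: 0; p; q; - p - q] =
    [seq 0 + -1 * s | s <- [:: 0; - p; - q; - - p - - q]].
  by congr [:: _; _; _; _]; ring.
apply: colorable_affine => //.
apply: colorable_zero_sum_odd; first by lia.
- by have [f def_p] := p_odd; exists (- f - 1); lia.
- by have [g def_q] := q_odd; exists (- g - 1); lia.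
- by rewrite Z.gcd_opp_l Z.gcd_opp_r.
Qed.

Lemma colorable_zero_sum_coprime (p q r : Z) :
  p + q + r = 0 -> Z.gcd p q = 1 -> uniq [:: 0; p; q; r] ->
  colorable 3 [:: 0; p; q; r].
Proof.
move=> sum0 coprime_pq; rewrite /= !inE !eqZE => distinct.
have gcd_sum a b : Z.gcd a (- a - b) = Z.gcd a b.
  have -> : - a - b = - (b + 1 * a) by ring.
  by rewrite Z.gcd_opp_r Z.gcd_add_mult_diag_r.
have [[f def_p]|p_odd] := Z.Even_or_Odd p;
  have [[g def_q]|q_odd] := Z.Even_or_Odd q.
- have : (2 | Z.gcd p q) by apply: Z.gcd_greatest; [exists f | exists g]; lia.
  by rewrite coprime_pq => -[d]; lia.
- apply: (colorable_subset (T := [:: 0; q; - q - p; - q - (- q - p)])).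
    have [-> ->] : - q - p = r /\ - q - (- q - p) = p by lia.
    by move=> w; rewrite !inE => /or4P[]->; rewrite ?orbT.
  apply: colorable_zero_sum_two_odd => //; try lia; last first.
    by rewrite gcd_sum Z.gcd_comm.
  by have [g def_q] := q_odd; exists (- g - f - 1); lia.
- apply: (colorable_subset (T := [:: 0; p; - p - q; - p - (- p - q)])).
    have [-> ->] : - p - q = r /\ - p - (- p - q) = q by lia.
    by move=> w; rewrite !inE => /or4P[]->; rewrite ?orbT.
  apply: colorable_zero_sum_two_odd => //; try lia; last by rewrite gcd_sum.
  by have [f def_p] := p_odd; exists (- g - f - 1); lia.
- have -> : r = - p - q by lia.
  by apply: colorable_zero_sum_two_odd => //; lia.
Qed.

Lemma colorable_zero_sum (p q r : Z) :
  p + q + r = 0 -> uniq [:: 0; p; q; r] -> colorable 3 [:: 0; p; q; r].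
Proof.
move=> sum0 distinct.
have [a def_p] := Z.gcd_divide_l p q; have [b def_q] := Z.gcd_divide_r p q.
have g_neq0 : Z.gcd p q <> 0.
  by move/Z.gcd_eq_0_l => p_eq0; move: distinct; rewrite p_eq0.
move def_g: (Z.gcd p q) g_neq0 def_p def_q => g g_neq0 def_p def_q.
have coprime_ab : Z.gcd a b = 1.
  have := Z.gcd_div_gcd p q g g_neq0 (esym def_g).
  by rewrite def_p def_q !Z.div_mul.
have def_r : r = g * (- a - b) by lia.
have -> : [:: 0; p; q; r] = [seq 0 + g * s | s <- [:: 0; a; b; - a - b]].
  by congr [:: _; _; _; _]; rewrite ?def_p ?def_q ?def_r; ring.
apply: colorable_affine => //.
apply: colorable_zero_sum_coprime => //; first by ring.
by move: distinct; rewrite def_r def_p def_q /= !inE !eqZE; nia.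
Qed.

(** * Small moduli *)

Definition circle_test (m : Z) (S : seq Z) : bool :=
  if sort Z.leb [seq s mod m | s <- S] is a :: s then gaps_at_most 3 m a s
  else false.

Lemma colorable_circle_test (m k : Z) (S : seq Z) :
  0 < m -> circle_test m [seq k * s | s <- S] -> colorable 3 S.
Proof.
move=> m_gt0; rewrite /circle_test; case def_T: (sort _ _) => [//|a T] gaps.
have cyclic_T := @cyclic_colorable_gaps 2 m a T m_gt0 gaps.
apply: (colorable_residues (u := k) cyclic_T) => t.
rewrite -def_T mem_sort => /mapP[_ /mapP[s Ss ->] ->]; exists s => //.
by exists (k * s / m); have := Z.div_mod (k * s) m ltac:(lia); lia.
Qed.

(* The search below finds no circle coloring of {0, 1, 7, 9}. *)
Definition word15 (i : Z) : Z :=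
  nth 0 [:: 0; 0; 0; 1; 0; 0; 1; 1; 1; 2; 2; 1; 2; 2; 2] (Z.to_nat i).

Lemma colorable_0179 : colorable 3 [:: 0; 1; 7; 9].
Proof.
suff [c _ Sc] : cyclic_colorable 15 3 [:: 0; 1; 7; 9] by exists c.
apply: (@cyclic_colorable_word _ 2 _ word15) => // x i x_15 i_3.
have x_range : x \in zrange 0 15 by rewrite mem_zrange; lia.
have i_range : i \in zrange 0 3 by rewrite mem_zrange; lia.
have check : all (fun x => all (fun i =>
    has (fun s => word15 ((x + s) mod 15) =? i) [:: 0; 1; 7; 9])
    (zrange 0 3)) (zrange 0 15) by vm_compute.
have /hasP[s Ss /Z.eqb_eq] := allP (allP check x x_range) i i_range.
by exists s.
Qed.

Definition excluded_case (a b c : Z) : bool :=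
  [|| Z.gcd a (Z.gcd b c) != 1, a + c =? 3 * b, b + c =? 3 * a,
      [&& a =? 1, b =? 7 & c =? 9] | [&& a =? 2, b =? 8 & c =? 9]].

Definition has_circle_coloring (max_modulus : Z) (S : seq Z) : bool :=
  search (fun m =>
    search (fun k => circle_test m [seq k * s | s <- S])
      (zrange 1 (m / 2 + 1)))
    (zrange 3 (max_modulus + 1)).

Definition small_check (lim max_modulus : Z) : bool :=
  all (fun a => all (fun b => all (fun c =>
      if excluded_case a b c then true
      else has_circle_coloring max_modulus [:: 0; a; b; c])
    (zrange (b + 1) (lim + a - b + 1))) (zrange (a + 1) (lim + 1)))
    (zrange 1 lim).

Lemma small_check_35_34 : small_check 35 34.
Proof. by vm_compute. Qed.

Lemma colorable_small (a b c : Z) :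
  0 < a -> a < b -> b < c -> b + c - a <= 35 -> Z.gcd a (Z.gcd b c) = 1 ->
  a + c <> 3 * b -> b + c <> 3 * a -> colorable 3 [:: 0; a; b; c].
Proof.
move=> a_gt0 ab bc small coprime_abc not_b_center not_a_center.
have a_range : a \in zrange 1 35 by rewrite mem_zrange; lia.
have b_range : b \in zrange (a + 1) (35 + 1) by rewrite mem_zrange; lia.
have c_range : c \in zrange (b + 1) (35 + a - b + 1) by rewrite mem_zrange; lia.
have := allP (allP (allP small_check_35_34 a a_range) b b_range) c c_range.
case: ifP => [|_ /searchP[m m_range /searchP[k _ circle]]]; last first.
  apply: (colorable_circle_test _ circle).
  by move: m_range; rewrite mem_zrange; lia.
rewrite /excluded_case coprime_abc eqxx /= => excluded _.
have [] : [:: a; b; c] = [:: 1; 7; 9] \/ [:: a; b; c] = [:: 2; 8; 9].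
  case/or4P: excluded => [/Z.eqb_eq//|/Z.eqb_eq//|/and3P[]|/and3P[]].
  - by move=> /Z.eqb_eq-> /Z.eqb_eq-> /Z.eqb_eq->; left.
  - by move=> /Z.eqb_eq-> /Z.eqb_eq-> /Z.eqb_eq->; right.
- by move=> [-> -> ->]; exact: colorable_0179.
- move=> [-> -> ->].
  apply: (colorable_subset (T := [seq 9 + -1 * s | s <- [:: 0; 1; 7; 9]])).
    by move=> s; rewrite !inE => /or4P[] /eqP->.
  exact: colorable_affine colorable_0179.
Qed.

(** * Four-element sets *)

Lemma colorable_centered (w x y z : Z) :
  x + y + z = 3 * w -> uniq [:: w; x; y; z] -> colorable 3 [:: w; x; y; z].
Proof.
move=> center distinct.
have -> : [:: w; x; y; z] = [seq w + 1 * s | s <- [:: 0; x - w; y - w; z - w]].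
  by congr [:: _; _; _; _]; ring.
apply: colorable_affine => //; apply: colorable_zero_sum; first by lia.
by move: distinct; rewrite /= !inE !eqZE; lia.
Qed.

Lemma generic_pairing (a b c : Z) :
  0 < a -> a < b -> b < c -> Z.gcd a (Z.gcd b c) = 1 ->
  a + c <> 3 * b -> b + c <> 3 * a -> generic (b + c - a) b c.
Proof.
move=> a_gt0 ab bc coprime_abc not_b_center not_a_center; split.
- set d := Z.gcd _ _; have d_b : (d | b) := Z.gcd_divide_l _ _.
  have d_cm : (d | Z.gcd c (b + c - a)) := Z.gcd_divide_r _ _.
  have d_c := Z.divide_trans _ _ _ d_cm (Z.gcd_divide_l _ _).
  have d_m := Z.divide_trans _ _ _ d_cm (Z.gcd_divide_r _ _).
  apply: Z.divide_1_r_nonneg; first exact: Z.gcd_nonneg.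
  rewrite -coprime_abc; apply: Z.gcd_greatest; last exact: Z.gcd_greatest.
  have -> : a = b + c - (b + c - a) by ring.
  by apply: Z.divide_sub_r => //; apply: Z.divide_add_r.
- by move/Z.divide_pos_le; lia.
- by move/Z.divide_pos_le; lia.
- case=> e def_e.
  have [e_eq0|[e_eqN1|e_out]] : e = 0 \/ e = -1 \/ e <= -2 \/ 1 <= e by lia.
  + by move: def_e; rewrite e_eq0; lia.
  + by move: def_e; rewrite e_eqN1; lia.
  + by case: e_out => e_out; nia.
- case=> e def_e; have [e_eq3|e_out] : e = 3 \/ e <= 2 \/ 4 <= e by lia.
  + by move: def_e; rewrite e_eq3; lia.
  + by case: e_out => e_out; nia.
Qed.

Lemma colorable_coprime (a b c : Z) :
  0 < a -> a < b -> b < c -> Z.gcd a (Z.gcd b c) = 1 ->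
  colorable 3 [:: 0; a; b; c].
Proof.
move=> a_gt0 ab bc coprime_abc.
have [b_center|not_b_center] := Z.eq_dec (a + c) (3 * b).
  apply: (colorable_subset (T := [:: b; 0; a; c])).
    by move=> s; rewrite !inE => /or4P[]->; rewrite ?orbT.
  by apply: colorable_centered; rewrite /= ?inE ?eqZE; lia.
have [a_center|not_a_center] := Z.eq_dec (b + c) (3 * a).
  apply: (colorable_subset (T := [:: a; 0; b; c])).
    by move=> s; rewrite !inE => /or4P[]->; rewrite ?orbT.
  by apply: colorable_centered; rewrite /= ?inE ?eqZE; lia.
have [small|large] := Z_le_gt_dec (b + c - a) 35; first exact: colorable_small.
apply: (colorable_subset (T := [:: 0; b; c; a])).
  by move=> s; rewrite !inE => /or4P[]->; rewrite ?orbT.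
have gen := generic_pairing a_gt0 ab bc coprime_abc not_b_center not_a_center.
apply: (@colorable_hits_spread (b + c - a)); [lia | by exists 1; ring | ].
have [medium|large_m] := Z_le_gt_dec (b + c - a) 225.
  by apply: hits_spread_medium gen; lia.
by apply: hits_spread_large gen; lia.
Qed.

Lemma colorable_increasing (a b c d : Z) :
  a < b -> b < c -> c < d -> colorable 3 [:: a; b; c; d].
Proof.
move=> ab bc cd; pose g := Z.gcd (b - a) (Z.gcd (c - a) (d - a)).
have [b' def_b] : (g | b - a) := Z.gcd_divide_l _ _.
have g_cd : (g | Z.gcd (c - a) (d - a)) := Z.gcd_divide_r _ _.
have [c' def_c] := Z.divide_trans _ _ _ g_cd (Z.gcd_divide_l _ _).
have [d' def_d] := Z.divide_trans _ _ _ g_cd (Z.gcd_divide_r _ _).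
have g_gt0 : 0 < g.
  have := Z.gcd_nonneg (b - a) (Z.gcd (c - a) (d - a)).
  by have := Z.gcd_eq_0_l (b - a) (Z.gcd (c - a) (d - a)); rewrite -/g; lia.
have coprime_bcd : Z.gcd b' (Z.gcd c' d') = 1.
  apply: (Z.mul_reg_r _ _ g); first lia.
  rewrite Z.mul_1_l -!Z.gcd_mul_mono_r_nonneg; try lia.
  by rewrite -def_b -def_c -def_d.
have -> : [:: a; b; c; d] = [seq a + g * s | s <- [:: 0; b'; c'; d']].
  by congr [:: _; _; _; _]; lia.
by apply: colorable_affine; [lia | apply: colorable_coprime => //; nia].
Qed.

Theorem theorem1 (S : seq int) (hS : uniq S) (hsz : size S = 4%N) :
  exists c : int -> 'I_3, polychromatic S c.
Proof.
have sorted_S : sorted <%O (sort <=%O S).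
  by rewrite Order.TotalTheory.sort_lt_sorted.
have size_sorted : size (sort <=%O S) = 4%N by rewrite size_sort.
apply: (colorable_subset (T := sort <=%O S)) => [x|].
  by rewrite mem_sort.
apply: (colorable_additive (f := Z_of_int)).
case: (sort _ _) sorted_S size_sorted => [|a [|b [|c [|d [|? ?]]]]] //=.
by move=> /and4P[ab bc cd _] _; apply: colorable_increasing; lia.
Qed.
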